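(* Let $x_1,x_2,y_1,y_2,u_1,u_2,v_1,v_2$ and $\mathbf w=(w_\ell)_{\ell\ge 0}$ be indeterminates, and for $n\ge 0$ define $$Q_n(x_1,x_2,y_1,y_2,u_1,u_2,v_1,v_2,\mathbf w)=\sum_{\sigma\in\mathfrak S_n} x_1^{\mathrm{eareccpeak}(\sigma)}x_2^{\mathrm{eareccdfall}(\sigma)}y_1^{\mathrm{ereccval}(\sigma)}y_2^{\mathrm{ereccdrise}(\sigma)}\,u_1^{\mathrm{nrcpeak}(\sigma)}u_2^{\mathrm{nrcdfall}(\sigma)}v_1^{\mathrm{nrcval}(\sigma)}v_2^{\mathrm{nrcdrise}(\sigma)}\,\mathbf w^{\mathbf{fix}(\sigma)}.$$ Then $$\sum_{n=0}^\infty Q_n(x_1,x_2,y_1,y_2,u_1,u_2,v_1,v_2,\mathbf w)\,t^n=\cfrac{1}{1-\gamma_0 t-\cfrac{\beta_1t^2}{1-\gamma_1t-\cfrac{\beta_2t^2}{1-\gamma_2 t-\cdots}}}$$ with coefficients $$\gamma_0=w_0,\qquad \gamma_n=[x_2+(n-1)u_2]+[y_2+(n-1)v_2]+w_n\quad(n\ge1),$$ $$\beta_n=[x_1+(n-1)u_1]\,[y_1+(n-1)v_1]\quad(n\ge 1).$$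
   Context: $\mathfrak S_n$ is the set of permutations of $[n]=\{1,\dots,n\}$. Continued fractions are identities of formal power series in $t$. For $\sigma\in\mathfrak S_n$, an index $i\in[n]$ is a record if $\sigma(j)<\sigma(i)$ for all $j<i$; an antirecord if $\sigma(j)>\sigma(i)$ for all $j>i$; an exclusive record if it is a record and not an antirecord; an exclusive antirecord if it is an antirecord and not a record; a neither-record-antirecord if it is neither a record nor an antirecord. An index $i$ is a cycle peak if $\sigma^{-1}(i)<i>\sigma(i)$; a cycle valley if $\sigma^{-1}(i)>i<\sigma(i)$; a cycle double rise if $\sigma^{-1}(i)<i<\sigma(i)$; a cycle double fall if $\sigma^{-1}(i)>i>\sigma(i)$; a fixed point if $\sigma(i)=i$. Statistics: $\mathrm{eareccpeak}(\sigma)$ [resp. $\mathrm{eareccdfall}(\sigma)$] is the number of exclusive antirecords that are also cycle peaks [resp. cycle double falls]; $\mathrm{ereccval}(\sigma)$ [resp. $\mathrm{ereccdrise}(\sigma)$] is the number of exclusive records that are also cycle valleys [resp. cycle double rises]; $\mathrm{nrcpeak},\mathrm{nrcval},\mathrm{nrcdrise},\mathrm{nrcdfall}$ are the numbers of neither-record-antirecords that are also cycle peaks, cycle valleys, cycle double rises, cycle double falls, respectively. If $i$ is a fixed point of $\sigma$, its level is $\mathrm{lev}(i,\sigma)=\#\{j<i:\sigma(j)>i\}=\#\{j>i:\sigma(j)<i\}$. We write $\mathbf w^{\mathbf{fix}(\sigma)}=\prod_{i:\,\sigma(i)=i}w_{\mathrm{lev}(i,\sigma)}$. *)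

(* Defs.v *)
From HB Require Import structures.
From mathcomp Require Import all_boot all_order all_algebra all_fingroup.

Set Implicit Arguments.
Unset Strict Implicit.
Unset Printing Implicit Defensive.

Import GRing.Theory.

(* Permutations of [n] = {1, ..., n} are represented by 'S_n, i.e. permutations
   of {0, ..., n-1}; every notion below only depends on the order of the
   indices, so the shift by one is harmless. *)
Section PermutationStatistics.

Local Open Scope nat_scope.

Variables (n : nat) (s : 'S_n).

Definition is_rec (i : 'I_n) : bool := [forall j : 'I_n, (j < i) ==> (s j < s i)].
Definition is_arec (i : 'I_n) : bool := [forall j : 'I_n, (i < j) ==> (s i < s j)].
Definition is_erec (i : 'I_n) : bool := is_rec i && ~~ is_arec i.
Definition is_earec (i : 'I_n) : bool := is_arec i && ~~ is_rec i.
Definition is_nrar (i : 'I_n) : bool := ~~ is_rec i && ~~ is_arec i.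

Definition is_cpeak (i : 'I_n) : bool := ((s^-1)%g i < i) && (s i < i).
Definition is_cval (i : 'I_n) : bool := (i < (s^-1)%g i) && (i < s i).
Definition is_cdrise (i : 'I_n) : bool := ((s^-1)%g i < i) && (i < s i).
Definition is_cdfall (i : 'I_n) : bool := (i < (s^-1)%g i) && (s i < i).
Definition is_fix (i : 'I_n) : bool := s i == i.

Definition eareccpeak : nat := #|[set i | is_earec i && is_cpeak i]|.
Definition eareccdfall : nat := #|[set i | is_earec i && is_cdfall i]|.
Definition ereccval : nat := #|[set i | is_erec i && is_cval i]|.
Definition ereccdrise : nat := #|[set i | is_erec i && is_cdrise i]|.
Definition nrcpeak : nat := #|[set i | is_nrar i && is_cpeak i]|.
Definition nrcval : nat := #|[set i | is_nrar i && is_cval i]|.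
Definition nrcdrise : nat := #|[set i | is_nrar i && is_cdrise i]|.
Definition nrcdfall : nat := #|[set i | is_nrar i && is_cdfall i]|.

Definition lev (i : 'I_n) : nat := #|[set j : 'I_n | (j < i) && (i < s j)]|.

Lemma lev_fixE (i : 'I_n) : is_fix i ->
  lev i = #|[set j : 'I_n | (i < j) && (s j < i)]|.
Proof.
move=> /eqP fi; rewrite /lev.
set A := [set j : 'I_n | (j < i) && (i < s j)].
set B := [set j : 'I_n | (i < j) && (s j < i)].
pose L := [set j : 'I_n | j < i].
pose L' := [set j : 'I_n | s j < i].
have cL : #|L'| = #|L|.
  rewrite -(card_imset L' (@perm_inj _ s)).
  congr #|pred_of_set _|; apply/setP=> j; rewrite inE; apply/imsetP/idP.
    by case=> k; rewrite inE => h ->.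
  by move=> h; exists ((s^-1)%g j); rewrite ?inE permKV.
have neq (j : 'I_n) : (j == i :> nat) = (s j == i :> nat).
  by rewrite !val_eqE -(inj_eq (@perm_inj _ s)) fi.
have eA : A = L :\: L'.
  apply/setP=> j; rewrite !inE -leqNgt [(i <= s j)%N]leq_eqVlt [nat_of_ord i == _]eq_sym -neq.
  by case: ltngtP => //=; rewrite ?andbF ?andbT.
have eB : B = L' :\: L.
  apply/setP=> j; rewrite !inE -leqNgt [(i <= j)%N]leq_eqVlt.
  rewrite [nat_of_ord i == _]eq_sym neq.
  by case: (ltngtP (s j) i) => //=; rewrite ?andbF ?andbT.
by rewrite eA eB !cardsD cL setIC.
Qed.

End PermutationStatistics.

Local Open Scope ring_scope.

Definition wfix (R : comNzRingType) (w : nat -> R) (n : nat) (s : 'S_n) : R :=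
  \prod_(i : 'I_n | is_fix s i) w (lev s i).

Definition Q (R : comNzRingType) (x1 x2 y1 y2 u1 u2 v1 v2 : R) (w : nat -> R)
    (n : nat) : R :=
  \sum_(s : 'S_n)
     x1 ^+ eareccpeak s * x2 ^+ eareccdfall s *
     y1 ^+ ereccval s * y2 ^+ ereccdrise s *
     u1 ^+ nrcpeak s * u2 ^+ nrcdfall s *
     v1 ^+ nrcval s * v2 ^+ nrcdrise s * wfix w s.

(* A formal power series is its coefficient sequence: f stands for
   \sum_n f n t^n. *)
Definition fps (R : comNzRingType) := nat -> R.

Section FormalPowerSeries.

Variable R : comNzRingType.
Implicit Types (f g : fps R).

Definition fps_poly (p : {poly R}) : fps R := fun n => p`_n.
Definition fps_sub f g : fps R := fun n => f n - g n.
Definition fps_mul f g : fps R := fun n => \sum_(i < n.+1) f i * g (n - i)%N.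

(* First n coefficients of 1 / f, for f with constant term 1, by solving
   f * g = 1 for one coefficient at a time. *)
Fixpoint fps_inv_seq f (n : nat) : seq R :=
  if n is m.+1 then
    let s := fps_inv_seq f m in
    rcons s ((m == 0%N)%:R - \sum_(i < m) f (m - i)%N * s`_i)
  else [::].

(* The multiplicative inverse, meaningful when f 0 = 1: see fps_mulV. *)
Definition fps_inv f : fps R := fun n => (fps_inv_seq f n.+1)`_n.

Lemma size_fps_inv_seq f n : size (fps_inv_seq f n) = n.
Proof. by elim: n => //= n IH; rewrite size_rcons IH. Qed.

Lemma nth_fps_inv_seq f n i : (i < n)%N -> (fps_inv_seq f n)`_i = fps_inv f i.
Proof.
elim: n => // n IH; rewrite ltnS leq_eqVlt => /predU1P[->//|lt_in].
by rewrite /= nth_rcons size_fps_inv_seq lt_in IH.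
Qed.

Lemma fps_invE f n :
  fps_inv f n = (n == 0%N)%:R - \sum_(i < n) f (n - i)%N * fps_inv f i.
Proof.
rewrite {1}/fps_inv /= nth_rcons size_fps_inv_seq ltnn eqxx.
by congr (_ - _); apply: eq_bigr => i _; rewrite nth_fps_inv_seq.
Qed.

Lemma fps_mulV f : f 0%N = 1 -> fps_mul f (fps_inv f) =1 fps_poly 1.
Proof.
move=> f0 n; rewrite /fps_mul /fps_poly coef1 (reindex_inj rev_ord_inj) /=.
rewrite big_ord_recr /= !subSS subnn subn0 f0 mul1r.
rewrite [X in _ + X]fps_invE addrC -addrA [X in _ + X]addrC.
rewrite (eq_bigr (fun i : 'I_n => f (n - i)%N * fps_inv f i)) ?subrr ?addr0 //.
by move=> i _; rewrite subSS subKn // ltnW.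
Qed.

(* Convergence in the t-adic topology: every coefficient is eventually
   constant. *)
Definition fps_cvg (u : nat -> fps R) f : Prop :=
  forall n, exists N : nat, forall m : nat, (N <= m)%N -> u m n = f n.

Lemma fps_cvg_unique (u : nat -> fps R) f g : fps_cvg u f -> fps_cvg u g -> f =1 g.
Proof.
move=> uf ug n; have [N hN] := uf n; have [M hM] := ug n.
by rewrite -(hN (maxn N M)) ?leq_maxl // hM // leq_maxr.
Qed.

(* The finite continued fraction
     1 / (1 - gamma_k t - beta_{k+1} t^2 / ( ... / (1 - gamma_{k+m} t))). *)
Fixpoint Jtrunc (gamma beta : nat -> R) (m k : nat) : fps R :=
  if m is m'.+1 then
    fps_inv (fps_sub (fps_poly (1 - gamma k *: 'X))
               (fps_mul (fps_poly (beta k.+1 *: 'X^2)) (Jtrunc gamma beta m' k.+1)))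
  else fps_inv (fps_poly (1 - gamma k *: 'X)).

(* f equals the infinite J-fraction with coefficients gamma_n (n >= 0) and
   beta_n (n >= 1), i.e. f is the limit of its convergents; beta 0 is unused. *)
Definition is_Jfraction (gamma beta : nat -> R) f : Prop :=
  fps_cvg (fun m => Jtrunc gamma beta m 0) f.

End FormalPowerSeries.

(* Main.v *)
Require Import Defs.
From mathcomp Require Import all_boot all_order all_algebra all_fingroup.
From mathcomp Require Import zify ring.

(** The theorem is the sum of two facts about weighted Motzkin paths: the
    generating polynomial of the symmetric group is a sum over such paths, and
    the generating function of the paths is a J-fraction.

    For the first, read a permutation s position by position and keep, after i
    steps, only the word s(0) ... s(i-1) in which the values that are at least i
    are replaced by i, i+1, ..., in the same relative order ([packed]).  If there
    are k such values, the positions holding them are the open positions, and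
    there are k missing values below i; k is the height of a Motzkin path.  To go
    from i to i+1 one decides whether the smallest open value becomes the final
    value i ([closes]) and which value position i receives ([adds]): one of the
    missing values, or a value above i in any relative order with those of the
    open positions.  The key point is that the cycle type, the record status and
    the level of position i can all be read off from the word of length i+1,
    and are unchanged by every later step, because a later step only shifts
    values at or above the current length, keeping their order.  An antirecord is
    visible in the prefix because an index i is an antirecord exactly when every
    value below s(i) has occurred before ([fills_one_line]); a record means that
    position i receives the largest value so far.  So if there are k ways to
    give position i a missing value below i, exactly one of them is an antirecord,
    and if there are k ways to give it a value above i, exactly one of them is a
    record; this produces the weights x + (k-1) u and y + (k-1) v.  Summing over all choices gives
    [pat_sum_children], and induction on the length gives [pat_sum_pats].

    For the second, let H_k be the generating function of the paths from height k
    to height 0, and J_k the continued fraction starting at level k.  Splitting a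
    path from height k > 0 at its first visit to height k-1 suggests
    H_k = J_k (down_k t H_{k-1}), and H_0 = J_0.  The first-step recurrence for H_k
    and this identity at level k+1 imply it at level k, modulo a power of t that
    grows with the depth of the truncation of the fraction
    ([motzkin_Jtrunc]). *)

Set Implicit Arguments.
Unset Strict Implicit.
Unset Printing Implicit Defensive.

Import GRing.Theory.
Local Open Scope ring_scope.

(** * Products and quotients of coefficient sequences *)

Section FpsArithmetic.

Variable R : comNzRingType.
Implicit Types f g h : fps R.

Definition trunc n f : {poly R} := \poly_(i < n.+1) f i.

Lemma coef_trunc n f i : (i <= n)%N -> (trunc n f)`_i = f i.
Proof. by move=> le_in; rewrite coef_poly ltnS le_in. Qed.

Lemma eq_coefM n (p p' q q' : {poly R}) :
    (forall i, (i <= n)%N -> p`_i = p'`_i) ->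
    (forall i, (i <= n)%N -> q`_i = q'`_i) ->
  (p * q)`_n = (p' * q')`_n.
Proof.
move=> eqp eqq; rewrite !coefM; apply: eq_bigr => i _.
by rewrite eqp ?eqq ?leq_subr // -ltnS.
Qed.

Lemma eq_fps_mul n f f' g g' :
    (forall i, (i <= n)%N -> f i = f' i) ->
    (forall i, (i <= n)%N -> g i = g' i) ->
  fps_mul f g n = fps_mul f' g' n.
Proof.
move=> eqf eqg; apply: eq_bigr => i _.
by rewrite eqf ?eqg ?leq_subr // -ltnS.
Qed.

(** The n-th coefficient of a product only involves coefficients up to n, so the
    ring laws of polynomials transfer to coefficient sequences. *)
Lemma fps_mul_trunc n f g i :
  (i <= n)%N -> fps_mul f g i = (trunc n f * trunc n g)`_i.
Proof.
move=> le_in; rewrite coefM; apply: eq_bigr => j _.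
by rewrite !coef_trunc //; have := ltn_ord j; lia.
Qed.

Lemma fps_mulC f g : fps_mul f g =1 fps_mul g f.
Proof. by move=> n; rewrite !(@fps_mul_trunc n) // mulrC. Qed.

Lemma fps_mulA f g h : fps_mul f (fps_mul g h) =1 fps_mul (fps_mul f g) h.
Proof.
move=> n; rewrite !(@fps_mul_trunc n) //.
have truncM a b i : (i <= n)%N ->
    (trunc n (fps_mul a b))`_i = (trunc n a * trunc n b)`_i.
  by move=> le_in; rewrite coef_trunc // -fps_mul_trunc.
rewrite (eq_coefM (p' := trunc n f) (q' := trunc n g * trunc n h)) //; last first.
  exact: truncM.
by rewrite mulrA; apply: eq_coefM => // i le_in; rewrite truncM.
Qed.

Lemma fps_mul_poly (p : {poly R}) f n :
  fps_mul (fps_poly p) f n = (p * trunc n f)`_n.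
Proof.
rewrite coefM; apply: eq_bigr => i _.
by rewrite coef_trunc // leq_subr.
Qed.

Lemma fps_mul1 f : fps_mul (fps_poly 1) f =1 f.
Proof. by move=> n; rewrite fps_mul_poly mul1r coef_trunc. Qed.

Lemma fps_mul_monomial c d f n :
  fps_mul (fps_poly (c *: 'X^d)) f n = if (n < d)%N then 0 else c * f (n - d)%N.
Proof.
rewrite fps_mul_poly -scalerAl coefZ coefXnM; case: ltnP => _; first by rewrite mulr0.
by rewrite coef_trunc // leq_subr.
Qed.

(** Division up to precision n: the equation f h = g is only required up
    to degree n, which is all that a truncated continued fraction can provide. *)
Lemma fps_divP f g h n :
    f 0%N = 1 -> (forall i, (i <= n)%N -> fps_mul f h i = g i) ->
  h n = fps_mul (fps_inv f) g n.
Proof.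
move=> f0 eqg; rewrite -(@eq_fps_mul _ (fps_inv f) _ (fps_mul f h)) //.
rewrite fps_mulA (@eq_fps_mul _ _ (fps_poly 1) _ h) ?fps_mul1 // => i _.
by rewrite fps_mulC fps_mulV.
Qed.

End FpsArithmetic.

(** * Weighted Motzkin paths and J-fractions *)

Section Motzkin.

Variables (R : comNzRingType) (up lvl down : nat -> R).

(** Total weight of the paths of length m from height k to height 0; [up k],
    [lvl k] and [down k] are the weights of the steps that leave height k. *)
Fixpoint motzkin (m k : nat) : R :=
  if m is m'.+1 then
    up k * motzkin m' k.+1 + lvl k * motzkin m' k +
      (if k is k'.+1 then down k * motzkin m' k' else 0)
  else (k == 0)%:R.

(** The factor left over when the excursion of a path above its starting height k
    is cut off: nothing for k = 0, and otherwise the step down to k-1 followed by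
    a path from k-1 to 0. *)
Definition entry (k : nat) : fps R := fun n =>
  match k, n with
  | 0, _ => (n == 0)%:R
  | k'.+1, n'.+1 => down k * motzkin n' k'
  | _, _ => 0
  end.

Let H (k : nat) : fps R := motzkin^~ k.

(** With D the denominator of the fraction at level k, the induction hypothesis
    at level k+1 turns beta_{k+1} t^2 J_{k+1} H_k into up_k t H_{k+1}; hence D H_k
    is what the first-step recurrence leaves of H_k, namely [entry k]. *)
Lemma motzkin_Jtrunc (beta : nat -> R) :
    (forall k, beta k.+1 = up k * down k.+1) ->
  forall m k n, (n <= m)%N ->
    motzkin n k = fps_mul (Jtrunc lvl beta m k) (entry k) n.
Proof.
move=> betaE; elim=> [|m IHm] k n le_nm.
  move: le_nm; rewrite leqn0 => /eqP->; rewrite -[LHS]/(H k 0%N); apply: fps_divP.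
    by rewrite /fps_poly coefB coef1 coefZ coefX mulr0 subr0.
  case=> // _; rewrite fps_mul_poly mulrBl mul1r coefB -scalerAl coefZ coefXM.
  by rewrite mulr0 subr0 coef_trunc //; case: k.
rewrite -[LHS]/(H k n); apply: fps_divP.
  rewrite /fps_sub fps_mul_monomial subr0.
  by rewrite /fps_poly coefB coef1 coefZ coefX mulr0 subr0.
move=> i le_in.
set J := Jtrunc lvl beta m k.+1.
have ->: fps_mul (fps_sub (fps_poly (1 - lvl k *: 'X))
                    (fps_mul (fps_poly (beta k.+1 *: 'X^2)) J)) (H k) i
    = fps_mul (fps_poly (1 - lvl k *: 'X)) (H k) i
      - fps_mul (fps_mul (fps_poly (beta k.+1 *: 'X^2)) J) (H k) i.
  by rewrite -sumrB; apply: eq_bigr => j _; rewrite mulrBl.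
rewrite -fps_mulA fps_mul_monomial fps_mul_poly mulrBl mul1r coefB -scalerAl.
rewrite coefZ coefXM.
case: i le_in => [|i] le_in /=.
  by rewrite mulr0 !subr0 coef_trunc //; case: k @J.
rewrite !coef_trunc //.
have IH : motzkin i k.+1 = fps_mul J (entry k.+1) i by apply: IHm; lia.
(* Both sides weigh the paths of length i.+1 that start with an up step. *)
have -> : (if (i.+1 < 2)%N then 0 else beta k.+1 * fps_mul J (H k) (i.+1 - 2)%N)
    = up k * motzkin i k.+1.
  have entryE j : entry k.+1 j = fps_mul (fps_poly (down k.+1 *: 'X^1)) (H k) j.
    by rewrite fps_mul_monomial; case: j => //= j; rewrite subn1.
  rewrite IH [in RHS]fps_mulC.
  rewrite (@eq_fps_mul _ i _ (fps_mul (fps_poly (down k.+1 *: 'X^1)) (H k)) _ J) //.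
  rewrite -fps_mulA fps_mul_monomial betaE.
  case: i {le_in IH} => [|i]; first by rewrite /= mulr0.
  by rewrite /= subn1 subn2 /= fps_mulC mulrA.
rewrite /H /=; case: k {J IH} => [|k] /=; ring.
Qed.

Lemma is_Jfraction_motzkin (beta : nat -> R) (f : fps R) :
    (forall k, beta k.+1 = up k * down k.+1) ->
    (forall n, f n = motzkin n 0) ->
  is_Jfraction lvl beta f.
Proof.
move=> betaE fE n; exists n => m le_nm.
rewrite fE (motzkin_Jtrunc betaE 0 le_nm) fps_mulC.
rewrite (@eq_fps_mul _ _ _ (fps_poly 1) _ (Jtrunc lvl beta m 0)) ?fps_mul1 //.
by move=> i _; rewrite /fps_poly coef1.
Qed.

End Motzkin.

(** * Prefix patterns of permutations *)

Lemma uniq_flatten_map (T U : eqType) (F : T -> seq U) (G : U -> T) (s : seq T) :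
    uniq s -> {in s, forall x, uniq (F x)} ->
    {in s, forall x, {in F x, forall y, G y = x}} ->
  uniq (flatten [seq F x | x <- s]).
Proof.
elim: s => //= x s IHs /andP[xs us] uF FK.
rewrite cat_uniq uF ?mem_head //= IHs //; first last.
- by move=> y ys; apply: FK; rewrite inE ys orbT.
- by move=> y ys; apply: uF; rewrite inE ys orbT.
rewrite andbT; apply/hasPn => y /flatten_mapP[z zs yFz]; apply: contra xs => yFx.
by rewrite -(FK x (mem_head _ _) y yFx) (FK z _ y yFz) // inE zs orbT.
Qed.

Section PrefixPatterns.

Local Open Scope nat_scope.

Implicit Types (p q : seq nat) (t k v x : nat).

Lemma mem_map_bump v p x :
  (x \in map (bump v) p) = (x != v) && (unbump v x \in p).
Proof.
apply/mapP/andP => [[y yp ->]|[nxv xp]].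
  by rewrite eq_sym neq_bump bumpK.
by exists (unbump v x); rewrite ?unbumpK //= inE.
Qed.

Lemma map_bumpK v p : map (unbump v) (map (bump v) p) = p.
Proof. by rewrite -map_comp map_id_in // => x _; apply: bumpK. Qed.

Lemma map_unbumpK v p : v \notin p -> map (bump v) (map (unbump v) p) = p.
Proof.
move=> vp; rewrite -map_comp map_id_in // => x xp; apply: unbumpK.
by apply: contraNneq vp => <-.
Qed.

Lemma mem_map_unbump v p x :
  v \notin p -> (x \in map (unbump v) p) = (bump v x \in p).
Proof.
by move=> vp; rewrite -{2}(map_unbumpK vp) mem_map //; apply: can_inj (@bumpK v).
Qed.

Lemma map_bump_uniq v p : uniq (map (bump v) p) = uniq p.
Proof. by rewrite map_inj_uniq //; apply: can_inj (@bumpK v). Qed.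

Lemma map_unbump_uniq v p : v \notin p -> uniq (map (unbump v) p) = uniq p.
Proof. by move=> vp; rewrite -(map_bump_uniq v) map_unbumpK. Qed.

(** Prefix patterns: the values below the threshold t are final, the others stand
    for values yet to be determined and only their relative order matters, so they
    are normalized to t, ..., t+k-1. *)
Definition packed t k p :=
  uniq p /\ forall x, t <= x -> (x \in p) = (x < t + k).

Lemma packed_count t k p : packed t k p -> count (leq t) p = k.
Proof.
move=> [up memp]; rewrite -size_filter -(size_iota t k); apply: perm_size.
apply: uniq_perm; rewrite ?filter_uniq ?iota_uniq // => x.
by rewrite mem_filter mem_iota; case: (leqP t x) => [/memp|].
Qed.

(** The values below t that are still available; kept increasing, so that the
    antirecord choice is the first one. *)
Definition gaps t p := [seq v <- iota 0 t | v \notin p].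

(** The entries of p lie below t + k and include t, ..., t+k-1, so the values missing
    below t + k are exactly the gaps. *)
Lemma size_gaps t k p : packed t k p -> size (gaps t p) + size p = t + k.
Proof.
move=> [up memp]; have perm_p : perm_eq (filter [in p] (iota 0 (t + k))) p.
  apply: uniq_perm; rewrite ?filter_uniq ?iota_uniq // => x.
  rewrite mem_filter mem_iota add0n /= andbC; case: ltnP => //= le_tk_x.
  by rewrite memp; lia.
rewrite -(perm_size perm_p) iotaD filter_cat size_cat /gaps !size_filter addnA.
rewrite [X in X + _]addnC (count_predC (mem p)) size_iota; congr addn.
rewrite -{2}(size_iota t k) -size_filter; congr size; apply/all_filterP/allP => x.
by rewrite add0n mem_iota => /andP[le_tx lt_x] /=; rewrite memp.
Qed.

Lemma packed_close t k p : packed t k.+1 p -> packed t.+1 k p.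
Proof. by move=> [up memp]; split=> // x lt_tx; rewrite memp ?addnS // ltnW. Qed.

Lemma packed_unclose t k p : t \in p -> packed t.+1 k p -> packed t k.+1 p.
Proof.
move=> tp [up memp]; split=> // x; rewrite leq_eqVlt => /predU1P[<-|lt_tx].
  by rewrite tp; lia.
by rewrite memp // addnS.
Qed.

Lemma packed_bump t k p : packed t k p -> packed t.+1 k (map (bump t) p).
Proof.
move=> [up memp]; split=> [|x lt_tx]; first by rewrite map_bump_uniq.
by rewrite mem_map_bump memp /unbump; lia.
Qed.

Lemma packed_unbump t k p :
  t \notin p -> packed t.+1 k p -> packed t k (map (unbump t) p).
Proof.
move=> tp [up memp]; split=> [|x le_tx]; first by rewrite map_unbump_uniq.
by rewrite mem_map_unbump // memp /bump; lia.
Qed.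

Lemma packed_rcons t k q v :
  v < t -> v \notin q -> packed t k q -> packed t k (rcons q v).
Proof.
move=> lt_vt vq [uq memq]; split=> [|x le_tx]; first by rewrite rcons_uniq vq.
by rewrite mem_rcons inE memq //; lia.
Qed.

Lemma packed_unrcons t k q v :
  v < t -> packed t k (rcons q v) -> v \notin q /\ packed t k q.
Proof.
move=> lt_vt [+ memq]; rewrite rcons_uniq => /andP[vq uq]; split=> //.
by split=> // x le_tx; rewrite -memq // mem_rcons inE; case: eqP => //; lia.
Qed.

(** Raising the values from v on makes room for v and keeps the relative order of
    the undetermined values: this is how a position gets an arbitrary rank. *)
Lemma packed_insert t k q v :
  t <= v <= t + k -> packed t k q -> packed t k.+1 (rcons (map (bump v) q) v).
Proof.
move=> /andP[le_tv le_vk] [uq memq]; split=> [|x le_tx].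
  by rewrite rcons_uniq map_bump_uniq uq mem_map_bump eqxx.
rewrite mem_rcons inE mem_map_bump; case: (eqVneq x v) => [->|nxv] /=; first lia.
by rewrite memq /unbump; lia.
Qed.

Lemma packed_delete t k q v :
    t <= v -> packed t k (rcons q v) ->
  [/\ v \notin q, t <= v < t + k & packed t k.-1 (map (unbump v) q)].
Proof.
move=> le_tv [+ memq]; rewrite rcons_uniq => /andP[vq uq].
have lt_vk : v < t + k by rewrite -memq // mem_rcons mem_head.
rewrite le_tv; split=> //; split=> [|x le_tx]; first by rewrite map_unbump_uniq.
have := memq (bump v x); rewrite mem_rcons inE eq_sym (negPf (neq_bump _ _)) /=.
rewrite mem_map_unbump // => ->; rewrite /bump; lia.
Qed.

(** The threshold moves from t = size p to t+1.  Either the entry t becomes final,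
    or all undetermined values are shifted, so that t is missing from the pattern;
    the former needs an undetermined value. *)
Definition closes p : seq (seq nat) :=
  let t := size p in
  if t \in p then [:: p; map (bump t) p] else [:: map (bump t) p].

(** The possible last entries: a missing value, which is final at once, or an
    undetermined value in any of its possible ranks. *)
Definition adds q : seq (seq nat) :=
  let t := (size q).+1 in
  [seq rcons q v | v <- gaps t q] ++
  [seq rcons (map (bump v) q) v | v <- iota t (count (leq t) q).+1].

(** Each pattern has a unique parent: [unclose] and [unadd] recover it, which gives
    both that the enumeration below has no repetition and that it is complete. *)
Definition unclose q :=
  if size q \in q then q else map (unbump (size q)) q.

Definition unadd p :=
  if p is x :: p' then
    let q := belast x p' in let v := last x p' in
    if size q < v then map (unbump v) q else q
  else [::].

Fixpoint pats n : seq (seq nat) :=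
  if n is m.+1 then
    flatten [seq adds q | q <- flatten [seq closes p | p <- pats m]]
  else [:: [::]].

Lemma unadd_rcons q v :
  unadd (rcons q v) = if size q < v then map (unbump v) q else q.
Proof. by case: q => //= x q; rewrite belast_rcons last_rcons. Qed.

Lemma closesK p q : q \in closes p -> unclose q = p.
Proof.
rewrite /closes /unclose; case: ifP => tp; rewrite !inE.
  case/orP=> /eqP->; first by rewrite tp.
  by rewrite size_map mem_map_bump eqxx map_bumpK.
by move/eqP->; rewrite size_map mem_map_bump eqxx map_bumpK.
Qed.

Lemma closes_unclose q : q \in closes (unclose q).
Proof.
rewrite /unclose; case: ifP => tq; rewrite /closes; first by rewrite tq mem_head.
rewrite size_map map_unbumpK ?tq //.
by case: ifP; rewrite !inE eqxx ?orbT.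
Qed.

Lemma closes_uniq p : uniq (closes p).
Proof.
rewrite /closes; case: ifP => //= tp; rewrite inE andbT.
by apply/eqP => E; rewrite E size_map mem_map_bump eqxx in tp.
Qed.

Lemma addsK q p : p \in adds q -> unadd p = q.
Proof.
rewrite mem_cat => /orP[]/mapP[v + ->]; rewrite unadd_rcons.
  by rewrite mem_filter mem_iota add0n => /andP[_]/=; case: ltnP => //; lia.
by rewrite mem_iota size_map => /andP[-> _]; rewrite map_bumpK.
Qed.

Lemma adds_uniq q : uniq (adds q).
Proof.
have lastK (F : nat -> seq nat) : injective (fun v => rcons (F v) v).
  by move=> v v' /(congr1 (last 0)); rewrite !last_rcons.
rewrite /adds cat_uniq (map_inj_uniq (lastK (fun=> q))) filter_uniq ?iota_uniq // andTb.
rewrite (map_inj_uniq (lastK (fun v => map (bump v) q))) iota_uniq andbT.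
apply/hasPn => _ /mapP[v + ->]; rewrite mem_iota => /andP[lt_qv _].
apply/mapP => -[v']; rewrite mem_filter mem_iota => /andP[_ /= lt_v'q].
by move/(congr1 (last 0)); rewrite !last_rcons; lia.
Qed.

Lemma closes_packed q p k : packed (size p) k p -> q \in closes p ->
  size q = size p /\ exists k', packed (size q).+1 k' q.
Proof.
move=> Pp; rewrite /closes; case: ifP => tp; rewrite !inE.
  case/orP=> /eqP->; last by rewrite size_map; split=> //; exists k; apply: packed_bump.
  split=> //; exists k.-1; apply: packed_close; rewrite prednK //.
  by case: Pp => _ /(_ (size p)); rewrite tp; lia.
by move/eqP->; rewrite size_map; split=> //; exists k; apply: packed_bump.
Qed.

Lemma adds_packed q p k : packed (size q).+1 k q -> p \in adds q ->
  size p = (size q).+1 /\ exists k', packed (size p) k' p.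
Proof.
move=> Pq; rewrite mem_cat => /orP[]/mapP[v + ->]; rewrite size_rcons ?size_map.
  rewrite mem_filter mem_iota => /andP[vq lt_v]; split=> //; exists k.
  exact: packed_rcons.
rewrite mem_iota (packed_count Pq) addnS ltnS => le_v; split=> //; exists k.+1.
exact: packed_insert.
Qed.

Lemma unclose_packed q k : packed (size q).+1 k q ->
  size (unclose q) = size q /\ exists k', packed (size q) k' (unclose q).
Proof.
move=> Pq; rewrite /unclose; case: ifP => tq.
  by split=> //; exists k.+1; apply: packed_unclose.
by rewrite size_map; split=> //; exists k; apply: packed_unbump; rewrite ?tq.
Qed.

Lemma unadd_packed q v k : packed (size q).+1 k (rcons q v) ->
  let q' := unadd (rcons q v) in
  [/\ size q' = size q, rcons q v \in adds q' & exists k', packed (size q).+1 k' q'].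
Proof.
move=> Pp; rewrite unadd_rcons; case: ltnP => [lt_qv|le_vq] /=.
  have [vq lt_vk Pq] := packed_delete lt_qv Pp.
  rewrite size_map; split=> //; last by exists k.-1.
  rewrite mem_cat; apply/orP; right; apply/mapP; exists v; last by rewrite map_unbumpK.
  by rewrite size_map mem_iota (packed_count Pq); lia.
have [vq Pq] := packed_unrcons (t := (size q).+1) le_vq Pp; split=> //; last by exists k.
by rewrite mem_cat map_f // mem_filter vq mem_iota.
Qed.

(** Completeness of the enumeration: a pattern of length n+1 is reached from its
    parent, which is again a pattern. *)
Lemma mem_pats n p : p \in pats n <-> size p = n /\ exists k, packed n k p.
Proof.
split; elim: n p => [|n IHn] p.
- by rewrite inE => /eqP->; split=> //; exists 0; split=> // x _; rewrite ltn0.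
- case/flatten_mapP=> q /flatten_mapP[p0 /IHn[sp0 [k0]]].
  rewrite -sp0 => Pp0 /(closes_packed Pp0)[sq [k1 Pq]] /(adds_packed Pq)[sp [k Pp]].
  by rewrite -sq -sp; split=> //; exists k.
- by case=> /size0nil->.
case=> sp [k Pp]; case/lastP: p sp Pp => // q v; rewrite size_rcons => -[sq] Pp; subst n.
have [sq' pq' [k' Pq']] := unadd_packed Pp; move: (unadd _) sq' pq' Pq' => q' sq' pq' Pq'.
rewrite -sq' in Pq'; have [sp0 Pp0] := unclose_packed Pq'.
apply/flatten_mapP; exists q' => //; apply/flatten_mapP; exists (unclose q').
  by apply: IHn; rewrite -sq'.
exact: closes_unclose.
Qed.

Lemma pats_uniq n : uniq (pats n).
Proof.
elim: n => //= n IHn; apply: (uniq_flatten_map (G := unadd)).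
- apply: (uniq_flatten_map (G := unclose)) => // p _; first exact: closes_uniq.
  by move=> q; apply: closesK.
- by move=> q _; apply: adds_uniq.
by move=> q _ p; apply: addsK.
Qed.

End PrefixPatterns.

(** * Weights of prefix patterns *)

Section PatternWeights.

Variables (R : comNzRingType) (x1 x2 y1 y2 u1 u2 v1 v2 : R) (w : nat -> R).
Implicit Types (p q : seq nat) (t k v : nat).

(** For a permutation and its prefix q before position i, [tops q v] says that
    i is a record when its value is v. *)
Definition tops q v := all (ltn^~ v) q.

(** For v < size q this says that the last entry of the pattern [rcons q v] is an
    antirecord: no smaller value is left for the later positions. *)
Definition fills q v := all [in q] (iota 0 v).

(** Weight of position i = size q when it receives v.  The test [i \in q] asks
    whether the preimage of i is smaller than i, so it separates peaks from double
    falls below the diagonal, and double rises from valleys above it. *)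
Definition last_weight q v : R :=
  let i := size q in
  if v == i then w (count (leq i.+1) q)
  else if (v < i)%N then
    if i \in q then (if fills q v then x1 else u1)
    else (if fills q v then x2 else u2)
  else
    if i \in q then (if tops q v then y2 else v2)
    else (if tops q v then y1 else v1).

Definition weight p : R := \prod_(i < size p) last_weight (take i p) (nth 0%N p i).

Lemma weight_rcons q v : weight (rcons q v) = weight q * last_weight q v.
Proof.
rewrite /weight size_rcons big_ord_recr /= nth_rcons ltnn eqxx -cats1.
rewrite take_cat ltnn subnn take0 cats0; congr (_ * _); apply: eq_bigr => i _.
by rewrite take_cat nth_cat ltn_ord.
Qed.

(** Later steps preserve the weight of earlier positions: they only shift values
    that lie above every position considered, and keep their order. *)
Lemma last_weight_bump h q v :
  (size q < h)%N -> last_weight (map (bump h) q) (bump h v) = last_weight q v.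
Proof.
move=> lt_qh; rewrite /last_weight size_map mem_map_bump.
have -> : (size q != h) && (unbump h (size q) \in q) = (size q \in q).
  have -> : unbump h (size q) = size q by rewrite /unbump; lia.
  by case: (_ \in q); lia.
have -> : (bump h v == size q) = (v == size q) by rewrite /bump; lia.
have -> : (bump h v < size q)%N = (v < size q)%N by rewrite /bump; lia.
have -> : tops (map (bump h) q) (bump h v) = tops q v.
  by rewrite /tops all_map; apply: eq_all => x /=; rewrite /bump; lia.
have -> : count (leq (size q).+1) (map (bump h) q) = count (leq (size q).+1) q.
  by rewrite count_map; apply: eq_count => x /=; rewrite /bump; lia.
case: (ltnP v (size q)) => // lt_vq.
have -> : bump h v = v by rewrite /bump; lia.
suff -> : fills (map (bump h) q) v = fills q v by [].
apply: eq_in_all => x; rewrite mem_iota /= mem_map_bump => lt_xv.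
have -> : unbump h x = x by rewrite /unbump; lia.
by case: (x \in q); lia.
Qed.

Lemma weight_bump h q : (size q <= h)%N -> weight (map (bump h) q) = weight q.
Proof.
move=> le_qh; rewrite /weight size_map; apply: eq_bigr => i _.
rewrite (nth_map 0%N) // -map_take last_weight_bump // size_take ltn_ord.
exact: leq_trans le_qh.
Qed.

(** Weight of a choice among m ordered possibilities, the first of weight a and
    the others of weight b; zero if there is no possibility. *)
Definition first_rest (a b : R) (m : nat) : R := if m is m'.+1 then a + m'%:R * b else 0.

Lemma sum_gaps (a b : R) t q :
  \sum_(v <- gaps t q) (if fills q v then a else b) = first_rest a b (size (gaps t q)).
Proof.
elim: t => [|t IHt]; first by rewrite big_nil.
rewrite /gaps -addn1 iotaD filter_cat /= add0n -/(gaps t q).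
case: ifPn => tq; last by rewrite cats0.
rewrite cats1 big_rcons size_rcons /= IHt.
have -> : fills q t = (size (gaps t q) == 0%N).
  by rewrite size_filter -leqn0 leqNgt -has_count has_predC negbK.
case: (size _) => [|m] /=; first by rewrite mul0r; ring.
by rewrite -natr1; ring.
Qed.

(** For t <= v < t + k the value v is already an entry, which the shift raises above
    the new last entry v; so only v = t + k is a record. *)
Lemma sum_inserts (a b : R) t k q : packed t k q ->
  \sum_(v <- iota t k.+1) (if tops (map (bump v) q) v then a else b) = a + k%:R * b.
Proof.
move=> [uq memq].
have topE v : (t <= v <= t + k)%N -> tops (map (bump v) q) v = (v == t + k)%N.
  case/andP=> le_tv le_vk; rewrite /tops all_map; apply/allP/eqP => [topv|-> x xq /=].
    apply/eqP; rewrite eqn_leq le_vk leqNgt; apply/negP => lt_vk.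
    by have := topv v; rewrite memq //= => /(_ lt_vk); rewrite /bump; lia.
  by have := memq x; rewrite xq /bump; lia.
rewrite -addn1 iotaD big_cat big_seq1 /= topE ?eqxx ?leq_addr ?leqnn // addrC.
congr (_ + _); transitivity (\sum_(v <- iota t k) b).
  rewrite big_seq [RHS]big_seq; apply: eq_bigr => v; rewrite mem_iota => Hv.
  by rewrite topE; last lia; case: eqP => //; lia.
by rewrite big_const_seq count_predT size_iota iter_addr_0 mulr_natl.
Qed.

Variable f : nat -> R.

Definition pat_sum (s : seq (seq nat)) : R :=
  \sum_(p <- s) weight p * f (count (leq (size p)) p).

(** With k undetermined values, k+1 values up to i = size q are missing.  If i has
    been used, all of them are below i; otherwise one of them is i itself, and
    choosing it creates a fixed point of level k. *)
Lemma pat_sum_adds q k : packed (size q).+1 k q ->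
  pat_sum (adds q) = weight q *
    (if size q \in q then first_rest x1 u1 k.+1 * f k + (y2 + k%:R * v2) * f k.+1
     else (w k + first_rest x2 u2 k) * f k + (y1 + k%:R * v1) * f k.+1).
Proof.
move=> Pq; rewrite /pat_sum /adds big_cat !big_map /=.
rewrite (packed_count Pq).
pose i := size q.
have -> : \sum_(v <- gaps i.+1 q)
      weight (rcons q v) * f (count (leq (size (rcons q v))) (rcons q v))
    = weight q * ((\sum_(v <- gaps i.+1 q) last_weight q v) * f k).
  rewrite mulr_suml mulr_sumr big_seq [RHS]big_seq; apply: eq_bigr => v.
  rewrite mem_filter mem_iota => /andP[vq lt_v].
  have /packed_count := packed_rcons lt_v vq Pq; rewrite size_rcons => ->.
  by rewrite weight_rcons mulrA.
have -> : \sum_(v <- iota i.+1 k.+1)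
      weight (rcons (map (bump v) q) v)
      * f (count (leq (size (rcons (map (bump v) q) v))) (rcons (map (bump v) q) v))
    = weight q * ((\sum_(v <- iota i.+1 k.+1) last_weight (map (bump v) q) v) * f k.+1).
  rewrite mulr_suml mulr_sumr big_seq [RHS]big_seq; apply: eq_bigr => v.
  rewrite mem_iota addnS ltnS => Hv.
  have /packed_count := packed_insert Hv Pq; rewrite size_rcons size_map => ->.
  by rewrite weight_rcons weight_bump ?mulrA //; lia.
have -> : \sum_(v <- iota i.+1 k.+1) last_weight (map (bump v) q) v
    = if i \in q then y2 + k%:R * v2 else y1 + k%:R * v1.
  have lastE v : v \in iota i.+1 k.+1 -> last_weight (map (bump v) q) v =
      if tops (map (bump v) q) v then (if i \in q then y2 else y1)
      else (if i \in q then v2 else v1).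
    rewrite mem_iota => /andP[lt_iv _]; rewrite /last_weight size_map mem_map_bump.
    have -> : unbump v (size q) = i by rewrite /unbump /i; lia.
    rewrite -/i (gtn_eqF lt_iv) (ltn_eqF lt_iv) ltnNge (ltnW lt_iv) /=.
    by case: (i \in q).
  rewrite (eq_big_seq _ lastE) (sum_inserts _ _ Pq).
  by case: (i \in q).
rewrite -mulrDr; congr (_ * _).
have gap_weight v : v \in gaps i q -> last_weight q v =
    if fills q v then (if i \in q then x1 else x2) else (if i \in q then u1 else u2).
  rewrite mem_filter mem_iota => /andP[_ /= lt_vi]; rewrite /last_weight -/i.
  by rewrite ltn_eqF // lt_vi; case: (i \in q).
have := size_gaps Pq; rewrite -/i.
rewrite /gaps -addn1 iotaD filter_cat /= add0n -/(gaps i q).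
case: ifPn; rewrite ?negbK => iq; rewrite ?cats0 ?cats1 ?size_rcons => szE.
  rewrite big_rcons (eq_big_seq _ gap_weight) sum_gaps (negPf iq) /=.
  have -> : size (gaps i q) = k by move: (size _) szE => g; lia.
  by rewrite /last_weight eqxx (packed_count Pq); ring.
rewrite (eq_big_seq _ gap_weight) sum_gaps iq.
by have -> : size (gaps i q) = k.+1 by move: (size _) szE => g; lia.
Qed.

End PatternWeights.

Section PatternSums.
Variables (R : comNzRingType) (x1 x2 y1 y2 u1 u2 v1 v2 : R) (w lvl : nat -> R).
Let up k := y1 + k%:R * v1.
Let down k := first_rest x1 u1 k.
Let M := motzkin up lvl down.
Let psum := pat_sum x1 x2 y1 y2 u1 u2 v1 v2 w.

(** One step of the reading of a permutation is one step of a Motzkin path: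
    peaks lower the height, valleys raise it, and double rises, double falls and
    fixed points keep it. *)
Lemma pat_sum_children m p k :
    (forall j, lvl j = first_rest x2 u2 j + first_rest y2 v2 j + w j) ->
  packed (size p) k p ->
  \sum_(q <- closes p) psum (M m) (adds q)
    = weight x1 x2 y1 y2 u1 u2 v1 v2 w p * M m.+1 k.
Proof.
move=> lvlE Pp; have Pb := packed_bump Pp.
have bumpE : psum (M m) (adds (map (bump (size p)) p)) = weight x1 x2 y1 y2 u1 u2 v1 v2 w p *
    ((w k + first_rest x2 u2 k) * M m k + up k * M m k.+1).
  rewrite /psum (@pat_sum_adds _ _ _ _ _ _ _ _ _ _ _ _ k) ?size_map //.
  by rewrite mem_map_bump eqxx /= weight_bump.
rewrite /closes; case: Pp (Pp) => _ /(_ _ (leqnn _)) -> Pp.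
case: k => [|k] in Pp Pb bumpE *; rewrite ?addn0 ?ltnn ?addnS ?ltnS ?leq_addr.
  by rewrite big_seq1 bumpE /M /= lvlE /=; ring.
rewrite big_cons big_seq1 bumpE.
rewrite /psum (pat_sum_adds _ _ _ _ _ _ _ _ _ _ (packed_close Pp)).
case: (Pp) => _ ->; rewrite // addnS ltnS leq_addr /M /= lvlE /down /=; ring.
Qed.

(** For m = 0 the sum is over the patterns without undetermined values, which are
    the permutations; the general m makes the induction work. *)
Lemma pat_sum_pats m n :
    (forall j, lvl j = first_rest x2 u2 j + first_rest y2 v2 j + w j) ->
  psum (M m) (pats n) = M (n + m) 0.
Proof.
move=> lvlE; elim: n m => [|n IHn] m.
  by rewrite /psum /pat_sum big_seq1 /weight big_ord0 mul1r.
rewrite addSnnS -IHn /psum /pat_sum /= big_flatten big_map big_flatten big_map.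
rewrite big_seq [RHS]big_seq; apply: eq_bigr => p /mem_pats[sp [k Pp]].
rewrite -sp in Pp; rewrite (packed_count Pp).
by rewrite -(pat_sum_children _ lvlE Pp).
Qed.
End PatternSums.

(** * Permutations as prefix patterns *)

Section OneLine.

Variable n : nat.
Implicit Types (s : 'S_n) (i j : 'I_n).
Local Open Scope nat_scope.

Definition one_line s : seq nat := [seq nat_of_ord (s i) | i <- enum 'I_n].

Lemma size_one_line s : size (one_line s) = n.
Proof. by rewrite size_map size_enum_ord. Qed.

Lemma nth_one_line s i : nth 0 (one_line s) i = s i.
Proof. by rewrite (nth_map i) ?size_enum_ord // nth_ord_enum. Qed.

Lemma one_line_inj : injective one_line.
Proof.
move=> s s' E; apply/permP => i; apply: val_inj.
by rewrite /= -!nth_one_line E.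
Qed.

Lemma mem_take_one_line s i x :
  reflect (exists2 j : 'I_n, j < i & s j = x :> nat) (x \in take i (one_line s)).
Proof.
apply: (iffP idP) => [/(nthP 0)[j]|[j lt_ji <-]].
  rewrite size_takel ?size_one_line ?(ltnW (ltn_ord i)) // => lt_ji.
  rewrite nth_take // => <-; have lt_jn := ltn_trans lt_ji (ltn_ord i).
  by exists (Ordinal lt_jn) => //; rewrite -nth_one_line.
rewrite -nth_one_line -(nth_take _ lt_ji) mem_nth //.
by rewrite size_takel ?size_one_line // ltnW.
Qed.

Lemma count_take_one_line (a : pred nat) s i :
  count a (take i (one_line s)) = #|[set j : 'I_n | (j < i) && a (s j)]|.
Proof.
have le_in := ltnW (ltn_ord i).
rewrite -sum1_count (big_nth 0) size_takel ?size_one_line // big_mkord.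
rewrite (big_ord_widen_cond n (fun k => a (nth 0 (take i (one_line s)) k)) (fun=> 1)) //.
rewrite -sum1_card; apply: eq_bigl => j; rewrite inE andbC.
by case: ltnP => //= lt_ji; rewrite nth_take // nth_one_line.
Qed.

Lemma packed_one_line s : packed n 0 (one_line s).
Proof.
split=> [|x le_nx].
  by rewrite map_inj_uniq ?enum_uniq // => i j /val_inj/perm_inj.
rewrite addn0 [RHS]ltnNge le_nx; apply/negP => /mapP[i _ xE].
by have := ltn_ord (s i); rewrite -xE ltnNge le_nx.
Qed.

Lemma one_line_surj p : size p = n -> packed n 0 p -> exists s, p = one_line s.
Proof.
move=> sp [up memp].
have lt_p (i : 'I_n) : nth 0 p i < n.
  by rewrite ltnNge; apply/negP => le_n; have := memp _ le_n; rewrite mem_nth ?sp //; lia.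
have F_inj : injective (fun i : 'I_n => Ordinal (lt_p i)).
  by move=> i j /(congr1 val)/= /eqP; rewrite nth_uniq ?sp // => /eqP/val_inj.
exists (perm F_inj); apply: (@eq_from_nth _ 0); rewrite ?size_one_line // sp => i lt_in.
by rewrite -[i]/(val (Ordinal lt_in)) nth_one_line permE.
Qed.

Lemma pats_one_line :
  perm_eq [seq p <- pats n | count (leq n) p == 0] [seq one_line s | s <- enum 'S_n].
Proof.
apply: uniq_perm; rewrite ?filter_uniq ?pats_uniq //.
  by rewrite (map_inj_uniq one_line_inj) enum_uniq.
move=> p; rewrite mem_filter; apply/andP/mapP => [[/eqP c0 /mem_pats[sp [k Pp]]]|].
  rewrite (packed_count Pp) in c0; subst k.
  by have [s ->] := one_line_surj sp Pp; exists s; rewrite ?mem_enum.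
case=> s _ ->; have Ps := packed_one_line s; rewrite (packed_count Ps); split=> //.
by apply/mem_pats; rewrite size_one_line; split=> //; exists 0.
Qed.

End OneLine.

Section Records.

Variables (n : nat) (s : 'S_n) (i : 'I_n).
Local Open Scope nat_scope.

Let q := take i (one_line s).

Lemma size_take_one_line : size q = i.
Proof. by rewrite size_takel ?size_one_line // ltnW. Qed.

Lemma tops_one_line : tops q (s i) = is_rec s i.
Proof.
apply/allP/forallP => [topi j|reci _ /mem_take_one_line[j lt_ji <-]].
  by apply/implyP => lt_ji; apply: topi; apply/mem_take_one_line; exists j.
by have /implyP := reci j; apply.
Qed.

(** A value that has not occurred before position i occurs after it. *)
Lemma fills_one_line : fills q (s i) = is_arec s i.
Proof.
apply/allP/forallP => [filli j|areci u].
  apply/implyP => lt_ij; rewrite ltn_neqAle leqNgt; apply/andP; split.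
    by rewrite val_eqE (inj_eq perm_inj); apply: contraTneq lt_ij => ->; rewrite ltnn.
  apply/negP => lt_s; have /filli : val (s j) \in iota 0 (s i) by rewrite mem_iota.
  by case/mem_take_one_line => j' lt_j'i /val_inj/perm_inj jE; rewrite -jE in lt_ij; lia.
rewrite mem_iota => /= lt_us; apply/mem_take_one_line.
have lt_un := ltn_trans lt_us (ltn_ord _).
exists ((s^-1)%g (Ordinal lt_un)); last by rewrite permKV.
have /implyP := areci ((s^-1)%g (Ordinal lt_un)); rewrite permKV /= => areci'.
case: ltngtP => // [/areci'|ij]; first by lia.
by move: lt_us; rewrite -(val_inj ij) permKV /= ltnn.
Qed.

Lemma closed_one_line : (val i \in q) = ((s^-1)%g i < i).
Proof.
apply/mem_take_one_line/idP => [[j lt_ji /val_inj sj]|lt_i].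
  by have -> : (s^-1)%g i = j by rewrite -sj permK.
by exists ((s^-1)%g i); rewrite ?permKV.
Qed.

Lemma take_one_line_uniq : uniq q.
Proof. by apply: take_uniq; have [] := packed_one_line s. Qed.

(** The i values before a record at i are distinct and below s i.  Together with
    the dual bound for antirecords, this makes every excedance that is a record
    exclusive, and every anti-excedance that is an antirecord exclusive. *)
Lemma rec_leq : is_rec s i -> i <= s i.
Proof.
rewrite -tops_one_line => /allP topi.
rewrite -[X in X <= _]size_take_one_line -[X in _ <= X](size_iota 0).
by apply: uniq_leq_size take_one_line_uniq _ => x /topi /=; rewrite mem_iota.
Qed.

Lemma arec_geq : is_arec s i -> s i <= i.
Proof.
rewrite -fills_one_line => /allP filli.
rewrite -[X in _ <= X]size_take_one_line -[X in X <= _](size_iota 0).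
by apply: uniq_leq_size (iota_uniq _ _) _ => x /filli.
Qed.

End Records.

Section PermutationWeights.

Variables (R : comNzRingType) (x1 x2 y1 y2 u1 u2 v1 v2 : R) (w : nat -> R).

(** At each index at most one of the nine factors differs from 1. *)
Lemma last_weight_one_line n (s : 'S_n) (i : 'I_n) :
  last_weight x1 x2 y1 y2 u1 u2 v1 v2 w (take i (one_line s)) (s i) =
    (if is_earec s i && is_cpeak s i then x1 else 1) *
    (if is_earec s i && is_cdfall s i then x2 else 1) *
    (if is_erec s i && is_cval s i then y1 else 1) *
    (if is_erec s i && is_cdrise s i then y2 else 1) *
    (if is_nrar s i && is_cpeak s i then u1 else 1) *
    (if is_nrar s i && is_cdfall s i then u2 else 1) *
    (if is_nrar s i && is_cval s i then v1 else 1) *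
    (if is_nrar s i && is_cdrise s i then v2 else 1) *
    (if is_fix s i then w (lev s i) else 1).
Proof.
rewrite /last_weight size_take_one_line tops_one_line fills_one_line.
rewrite closed_one_line count_take_one_line -/(lev s i).
rewrite /is_earec /is_erec /is_nrar /is_cpeak /is_cval /is_cdrise /is_cdfall /is_fix.
have := @rec_leq _ s i; have := @arec_geq _ s i.
have invE : ((s^-1)%g i == i :> nat) = (s i == i :> nat).
  by rewrite !val_eqE -(inj_eq (@perm_inj _ s)) permKV eq_sym.
have -> : (s i == i) = (s i == i :> nat) by [].
move: invE; case: (ltngtP (s i) i) => _ /=; case: (ltngtP ((s^-1)%g i) i) => _ //= _;
  case: (is_rec s i) => //=; case: (is_arec s i) => //= arec rec;
  first [by rewrite ?mulr1 ?mul1r | by have := rec isT | by have := arec isT].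
Qed.

Lemma prod_if_card (I : finType) (P : pred I) (x : R) :
  \prod_i (if P i then x else 1) = x ^+ #|[set i | P i]|.
Proof. by rewrite -big_mkcond -prodr_const; apply: eq_bigl => i; rewrite inE. Qed.

(** Permutations are the patterns without undetermined values, and their monomials
    factor over the positions. *)
Lemma Q_pat_sum n : Q x1 x2 y1 y2 u1 u2 v1 v2 w n =
  \sum_(p <- pats n | count (leq n) p == 0%N) weight x1 x2 y1 y2 u1 u2 v1 v2 w p.
Proof.
rewrite -big_filter (perm_big _ (pats_one_line n)) big_map big_enum /=.
apply: eq_bigr => s _; rewrite /weight.
rewrite -(big_mkord xpredT (fun i => last_weight x1 x2 y1 y2 u1 u2 v1 v2 w
            (take i (one_line s)) (nth 0%N (one_line s) i))) size_one_line big_mkord.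
under [RHS]eq_bigr => i _ do rewrite nth_one_line last_weight_one_line.
by rewrite !big_split /= !prod_if_card /wfix [in LHS]big_mkcond.
Qed.

End PermutationWeights.

Theorem theorem2p2 (R : comNzRingType) (x1 x2 y1 y2 u1 u2 v1 v2 : R)
    (w : nat -> R) (gamma beta : nat -> R)
    (gamma0 : gamma 0%N = w 0%N)
    (gammaS : forall n : nat, (1 <= n)%N ->
       gamma n = (x2 + (n - 1)%:R * u2) + (y2 + (n - 1)%:R * v2) + w n)
    (betaS : forall n : nat, (1 <= n)%N ->
       beta n = (x1 + (n - 1)%:R * u1) * (y1 + (n - 1)%:R * v1)) :
  is_Jfraction gamma beta (fun n : nat => Q x1 x2 y1 y2 u1 u2 v1 v2 w n).
Proof.
pose up k := y1 + k%:R * v1; pose down k := first_rest x1 u1 k.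
apply: (@is_Jfraction_motzkin _ up gamma down) => [k|n].
  by rewrite betaS // subn1 mulrC.
rewrite Q_pat_sum.
have gammaE j : gamma j = first_rest x2 u2 j + first_rest y2 v2 j + w j.
  by case: j => [|j]; rewrite ?gamma0 ?gammaS //= ?subn1 ?add0r.
have := pat_sum_pats x1 y1 u1 v1 0 n gammaE; rewrite addn0 => <-.
rewrite /pat_sum big_mkcond big_seq [RHS]big_seq.
apply: eq_bigr => p /mem_pats[-> _] /=.
by case: eqP => _; rewrite ?mulr1 ?mulr0.
Qed.
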